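(* Let $p\in(0,1)$. Suppose the probability distribution $F$ on $\mathbb{R}$ has finite $k$-th moment, $k\ge1$, and non-zero Expected Shortfall at level $p$ (that is, $\mathrm{ES}_p(X)\ne 0$ for $X\sim F$). Then, as $n\to\infty$, $$\frac{\sup_{S\in\mathfrak S_n}\mathrm{VaR}_p(S)}{\sup_{S\in\mathfrak S_n}\mathrm{ES}_p(S)}=1-o(n^{-1+1/k}).$$
   Context: All random variables are defined on a common atomless probability space $(\Omega,\mathcal A,\mathbb P)$, on which independent random vectors with any distributions can be generated. For a distribution $F$, $\mathfrak S_n=\{X_1+\cdots+X_n: X_i\sim F,\ i=1,\ldots,n\}$ (sums with arbitrary dependence). The Value-at-Risk is $\mathrm{VaR}_p(X)=\inf\{x:\mathbb P(X\le x)\ge p\}$, $p\in(0,1)$, and the Expected Shortfall is $\mathrm{ES}_p(X)=\frac{1}{1-p}\int_p^1\mathrm{VaR}_\alpha(X)\,d\alpha$, $p\in[0,1)$. Here $k$ is a real number, and finite $k$-th moment means $\mathbb{E}[|X|^k]<\infty$ for $X\sim F$. *)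

(* Defs.v *)
From HB Require Import structures.
From mathcomp Require Import all_boot all_order all_algebra.
From mathcomp Require Import all_classical all_reals all_analysis.

Set Implicit Arguments.
Unset Strict Implicit.
Unset Printing Implicit Defensive.

Import Order.TTheory GRing.Theory Num.Theory.
Import numFieldNormedType.Exports.

Local Open Scope classical_set_scope.
Local Open Scope ring_scope.

Section aggregation.
Context (d : measure_display) (T : measurableType d) (R : realType).
Variable P : probability T R.

Definition atomless : Prop :=
  forall A : set T, measurable A -> (0 < P A)%E ->
    exists B : set T,
      [/\ measurable B, B `<=` A, (0 < P B)%E & (P B < P A)%E].

(* Equality of measures is only required on measurable sets: as functions on
   [set R], a distribution and its copies may differ on non-measurable sets. *)
Definition has_law (d' : measure_display) (T' : measurableType d')
    (X : {RV P >-> T'}) (F : probability T' R) : Prop :=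
  forall A : set T', measurable A -> distribution P X A = F A.

(* Events [A i] may be the full space, so the product rule over the whole index
   set entails the product rule over every subfamily. *)
Definition independent_vectors (m : nat) (n : 'I_m -> nat)
    (X : forall i, {RV P >-> (n i).-tuple R}) : Prop :=
  forall A : forall i, set ((n i).-tuple R), (forall i, measurable (A i)) ->
    P (\bigcap_(i in [set: 'I_m]) (X i @^-1` A i)) =
    (\prod_(i < m) P (X i @^-1` A i))%E.

Definition generates_independent_vectors : Prop :=
  forall (m : nat) (n : 'I_m -> nat)
    (mu : forall i, probability ((n i).-tuple R) R),
  exists2 X : forall i, {RV P >-> (n i).-tuple R},
    forall i, has_law (X i) (mu i) & independent_vectors X.

Definition sums (F : probability R R) (n : nat) : set {RV P >-> R} :=
  [set S : {RV P >-> R} | exists2 X : 'I_n -> {RV P >-> R},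
             forall i, has_law (X i) F & forall w, S w = \sum_(i < n) X i w].

(* For 0 < a < 1 the set is nonempty and bounded below, so this real-valued
   [inf] is the true infimum. *)
Definition VaR (a : R) (X : {RV P >-> R}) : R :=
  inf [set x | (a%:E <= cdf X x)%E].

(* The endpoints, where [VaR] may fail to be finite, are left out of the domain
   of integration. *)
Definition ES (p : R) (X : {RV P >-> R}) : \bar R :=
  ((1 - p)^-1%:E * \int[lebesgue_measure]_(a in `]p, 1%R[) (VaR a X)%:E)%E.

Definition sup_VaR (p : R) (F : probability R R) (n : nat) : \bar R :=
  ereal_sup [set (VaR p S)%:E | S in sums F n].

Definition sup_ES (p : R) (F : probability R R) (n : nat) : \bar R :=
  ereal_sup [set ES p S | S in sums F n].

End aggregation.

(* Main.v *)
Require Import Defs.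
From HB Require Import structures.
From mathcomp Require Import all_boot all_order all_algebra.
From mathcomp Require Import all_classical all_reals all_analysis.
From mathcomp Require Import measurable_realfun ring lra.

(* Let Q a = VaR_a(X), the quantile function of F.  Testing the representation
   ES_p(S) = min_t (t + E[(S - t)^+] / (1 - p)) at t = n Q(p) bounds ES_p(S) by
   n ES_p(X) for every S in the class, with equality for S = n X.

   For the lower bound on the sup of VaR, put w = (1 - p) / (n - 1), cut
   (p - w, 1) into n cells of length w, let U be uniform on (0, 1), and set
   X_i = Q (phi_i U), where phi_i fixes (0, p - w] and rotates (p - w, 1) by i
   cells.  Each phi_i preserves the uniform law, and on {U > p - w} the n points
   phi_i U fall in distinct cells; as Q is nondecreasing, the sum of the X_i
   there is at least the sum of Q over the left ends of the cells, which is at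
   least n ES_p(X) - O(1) - w^-1 int_(1-w)^1 Q.  The event has probability
   greater than 1 - p, so this lower bound passes to VaR_p.  Finally
   y <= c + c^(1-k) |y|^k with c of order n^(1/k), together with
   int_(1-w)^1 |Q|^k -> 0, makes the last term o(n^(1/k)). *)

Set Implicit Arguments.
Unset Strict Implicit.
Unset Printing Implicit Defensive.

Import Order.TTheory GRing.Theory Num.Theory.
Import numFieldNormedType.Exports.

Local Open Scope classical_set_scope.
Local Open Scope ring_scope.

(** * Laws on the line and their quantile functions *)

(** The open right rays are stable under intersection and generate the Borel sets, and their masses
    are fixed by those of the complementary left rays, so uniqueness of measures applies. *)
Lemma eq_probability_itvNyc (R : realType) (mu nu : probability R R) :
  (forall x : R, mu `]-oo, x]%classic = nu `]-oo, x]%classic) ->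
  forall A, measurable A -> mu A = nu A.
Proof.
move=> munu A mA.
apply: (measure_unique (@RGenOInfty.G R)
  (fun k : nat => `](- k%:R), +oo[%classic)) => //.
- exact: RGenOInfty.measurableE.
- move=> _ _ [x ->] [y ->]; exists (Num.max x y).
  by apply/seteqP; split => z /=; rewrite !in_itv/= !andbT gt_max => /andP.
- by move=> i; exists (- i%:R).
- apply/seteqP; split => // x _; exists (Num.truncn `|x|).+1 => //=.
  rewrite in_itv/= andbT ltrNl (le_lt_trans (ler_norm _))// normrN.
  exact: truncnS_gt.
- move=> _ [x ->].
  rewrite -setCitvl [LHS](probability_setC mu)// [RHS](probability_setC nu)//.
  by rewrite munu.
- by move=> k; rewrite (le_lt_trans (probability_le1 _ _)) ?ltry.
Qed.

Section quantile.
Context (d : measure_display) (T : measurableType d) (R : realType).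
Variables (P : probability T R) (X : {RV P >-> R}).

Lemma has_inf_VaR (a : R) : 0 < a < 1 -> has_inf [set x | (a%:E <= cdf X x)%E].
Proof.
move=> /andP[a0 a1].
have cdfE x : cdf X x = (fine (cdf X x))%:E by rewrite fineK// fin_num_measure.
split.
  have : \forall x \near +oo%R, a < fine (cdf X x).
    by have /fine_cvg/cvgr_gt := cvg_cdfy1 X; exact.
  by move=> /filter_ex[x ax]; exists x; rewrite /= cdfE lee_fin ltW.
have : \forall x \near -oo%R, fine (cdf X x) < a.
  by have /fine_cvg/cvgr_lt := cvg_cdfNy0 X; exact.
move=> [M [_ MX]]; exists (M - 1) => x /= ax.
rewrite leNgt; apply/negP => xM.
have := MX x; rewrite (lt_trans xM) ?ltrBlDr ?ltrDl// => /(_ isT).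
by rewrite ltNge -lee_fin -cdfE ax.
Qed.

(** The infimum is attained: every point to its right satisfies the inequality, and the distribution
    function is right-continuous. *)
Lemma cdf_VaR (a : R) : 0 < a < 1 -> (a%:E <= cdf X (VaR a X))%E.
Proof.
move=> a01; have infA := has_inf_VaR a01.
set v := VaR a X.
have Xv : cdf X x @[x --> v^'+] --> cdf X v by exact: cdf_right_continuous.
apply: (cvge_ge _ Xv).
near=> x; have vx : v < x by near: x; exact: nbhs_right_gt.
have xv0 : 0 < x - v by rewrite subr_gt0.
have [y ay yx] := inf_adherent xv0 infA.
rewrite -/(VaR a X) -/v subrKC in yx.
by rewrite (le_trans ay)// cdf_nondecreasing// ltW.
Unshelve. all: by end_near. Qed.

(** This Galois connection lets later arguments compare quantiles through [cdf] without returning to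
    the infimum. *)
Lemma VaR_le (a x : R) : 0 < a < 1 -> (VaR a X <= x) = (a%:E <= cdf X x)%E.
Proof.
move=> a01; apply/idP/idP => [vx|ax].
  by rewrite (le_trans (cdf_VaR a01))// cdf_nondecreasing.
by apply: ge_inf => //; exact: (has_inf_VaR a01).2.
Qed.

Lemma VaR_nondecreasing (a b : R) : 0 < a -> a <= b -> b < 1 ->
  VaR a X <= VaR b X.
Proof.
move=> a0 ab b1; rewrite VaR_le ?a0 ?(le_lt_trans ab)//.
by rewrite (@le_trans _ _ b%:E) ?lee_fin// cdf_VaR// b1 (lt_le_trans a0).
Qed.

Lemma measurable_VaR :
  measurable_fun (`]0, 1[%classic : set R) (fun a : R => VaR a X).
Proof.
apply: (measurability (@RGenCInfty.G R)) => [|/= _ [_] [r] -> <-].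
  exact: RGenCInfty.measurableE.
(* By monotonicity the preimage of a right ray is an interval. *)
apply: is_interval_measurable => s t/=.
rewrite !in_itv/= !andbT => -[/andP[s0 s1] rs] [/andP[t0 t1] rt] u /andP[su ut].
split; first by rewrite /= in_itv/= (lt_le_trans s0)// (le_lt_trans ut).
by rewrite /= in_itv/= andbT (le_trans rs)// VaR_nondecreasing// (le_lt_trans ut).
Qed.

(** The extension by 0 outside the open unit interval makes a total measurable function, which can
    be composed with random variables; the uniform law does not charge the points where the default
    is taken. *)
Definition quantile : R -> R := (fun a => VaR a X) \_ `]0, 1[.

Lemma quantileE (a : R) : 0 < a < 1 -> quantile a = VaR a X.
Proof. by move=> a01; rewrite /quantile patchE mem_set. Qed.

Lemma measurable_quantile : measurable_fun setT quantile.
Proof.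
by apply/(measurable_restrictT _ _).1 => //; exact: measurable_VaR.
Qed.

End quantile.

(** * A quantile function applied to a uniform variable *)

Section unit_uniform.
Context (R : realType).
Local Notation mu := (@lebesgue_measure R).
Local Notation nu := (uniform_prob (@ltr01 R)).

Lemma integral_unit_uniform (f : R -> \bar R) :
  measurable_fun setT f -> (forall x, 0 <= f x)%E ->
  (\int[nu]_x f x = \int[mu]_(x in `]0%R, 1%R[) f x)%E.
Proof.
move=> mf f0; rewrite integral_uniform// subr0 invr1 mul1e.
by rewrite (@integral_itv_bndoo _ _ _ _ true false)//; exact: measurable_funTS.
Qed.

Lemma unit_uniformE (A : set R) : measurable A ->
  nu A = mu (A `&` `]0%R, 1%R[).
Proof.
move=> mA; rewrite -[A in LHS]setIT -integral_indic//.
rewrite integral_unit_uniform//; first by rewrite integral_indic.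
exact/measurable_EFinP/measurable_indic.
Qed.

End unit_uniform.

Section quantile_law.
Context (d : measure_display) (T : measurableType d) (R : realType).
Variables (P : probability T R) (X : {RV P >-> R}).
Local Notation nu := (uniform_prob (@ltr01 R)).

Lemma quantile_law (A : set R) : measurable A ->
  nu (quantile X @^-1` A) = distribution P X A.
Proof.
have mq : (quantile X : measurableTypeR R -> R) \in mfun.
  by rewrite inE; exact: measurable_quantile.
move=> mA; pose Q : {RV nu >-> R} := mfun_Sub mq.
rewrite -[LHS]/(distribution nu Q A).
apply: eq_probability_itvNyc => // x.
rewrite -[RHS]/(cdf X x).
have c0 : 0 <= fine (cdf X x) by rewrite fine_ge0.
have c1 : fine (cdf X x) <= 1.
  by rewrite -lee_fin fineK ?fin_num_measure// cdf_le1.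
have cdfE : cdf X x = (fine (cdf X x))%:E by rewrite fineK// fin_num_measure.
move: cdfE c0 c1; set c := fine _ => cdfE c0 c1.
rewrite -[LHS]/(nu (quantile X @^-1` `]-oo, x]%classic)) unit_uniformE; last first.
  rewrite -[X in measurable X]setTI.
  by apply: measurable_quantile.
rewrite cdfE.
(* By [VaR_le], the quantile at [a] is at most [x] exactly when [a <= c]. The right end is included,
   except for [c = 1], which lies outside the domain. *)
have -> : quantile X @^-1` `]-oo, x] `&` `]0, 1[ =
    [set` Interval (BRight 0) (BSide (c == 1) c)].
  apply/seteqP; split => a /=; rewrite !in_itv/=.
    move=> [+ a01]; rewrite quantileE// VaR_le// cdfE lee_fin => ac.
    rewrite (andP a01).1/=; case: eqP => [->|//].
    exact: (andP a01).2.
  move=> /andP[a0 ac].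
  have a01 : 0 < a < 1.
    rewrite a0/=; case: eqP ac => [->//|/eqP c_neq1 /le_lt_trans]; apply.
    by rewrite lt_neqAle c_neq1.
  split => //; rewrite quantileE// VaR_le// cdfE lee_fin.
  by case: eqP ac => // _ /ltW.
by rewrite lebesgue_measure_itv/= lte_fin; case: ltP => [_|]; 
   rewrite ?sube0// => c0'; congr EFin; apply/le_anti; rewrite c0 c0'.
Qed.

End quantile_law.

Lemma integrable_cst_itv (R : realType) (a b c : R) (b0 b1 : bool) :
  (@lebesgue_measure R).-integrable [set` Interval (BSide b0 a) (BSide b1 b)]
    (fun=> c%:E).
Proof.
apply: (@measurable_bounded_integrable _ _ _ _ (cst c)) => //.
  by rewrite /= lebesgue_measure_itv/=; case: ifP => _; rewrite -?EFinB ltry.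
exists `|c|; split; first exact: num_real.
by move=> M cM x _ /=; rewrite ltW.
Qed.

(** * Integrals of quantiles and the excess representation of Expected Shortfall *)

Section quantile_integral.
Context (d : measure_display) (T : measurableType d) (R : realType).
Variables (P : probability T R) (X : {RV P >-> R}).
Local Notation mu := (@lebesgue_measure R).
Local Notation nu := (uniform_prob (@ltr01 R)).

(** Change of variables: [X] has the law of its quantile function under the uniform probability. *)
Lemma ge0_integral_VaR (f : R -> \bar R) :
  measurable_fun setT f -> (forall y, (0 <= f y)%E) ->
  (\int[P]_w f (X w) = \int[mu]_(a in `]0%R, 1%R[) f (VaR a X))%E.
Proof.
move=> mf f0.
have mq : (quantile X : measurableTypeR R -> R) \in mfun.
  by rewrite inE; exact: measurable_quantile.
pose Q : {RV nu >-> R} := mfun_Sub mq.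
rewrite -(ge0_integral_distribution X)//.
rewrite (eq_measure_integral (distribution nu Q)); last first.
  by move=> A mA _; exact/esym/quantile_law.
rewrite ge0_integral_distribution// integral_unit_uniform//; last first.
- by move=> x; exact: f0.
- exact: (measurableT_comp mf (measurable_quantile X)).
by apply: eq_integral => a; rewrite inE/= in_itv/= => a01; rewrite quantileE.
Qed.

Hypothesis iX : P.-integrable setT (EFin \o X).

Lemma integrable_VaR01 : mu.-integrable `]0%R, 1%R[ (fun a => (VaR a X)%:E).
Proof.
apply/integrableP; split.
  by apply/measurable_EFinP; exact: measurable_VaR.
move/integrableP : iX => [_]; congr (_ < _)%E.
apply: (@ge0_integral_VaR (fun y => `|y%:E|%E)) => //.
by do 2 apply: measurableT_comp => //.
Qed.

Lemma integrable_VaR (A : set R) : measurable A -> A `<=` `]0, 1[%classic ->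
  mu.-integrable A (fun a => (VaR a X)%:E).
Proof. by move=> mA A01; apply: integrableS integrable_VaR01. Qed.

Let sub01 (p : R) : 0 < p -> `]p, 1[%classic `<=` (`]0, 1[%classic : set R).
Proof. by move=> p0; apply: subset_itvr; rewrite bnd_simp ltW. Qed.

Lemma ESE (p : R) : 0 < p ->
  ES p X = ((1 - p)^-1 * \int[mu]_(a in `]p, 1[) VaR a X)%:E.
Proof.
move=> p0; rewrite /ES /Rintegral EFinM fineK//.
apply: integrable_fin_num => //; apply: integrable_VaR => //; exact: sub01.
Qed.

Lemma Rintegral_VaR_ge (a b c : R) (b0 b1 : bool) : a < b ->
  [set` Interval (BSide b0 a) (BSide b1 b)] `<=` `]0, 1[%classic ->
  {in Interval (BSide b0 a) (BSide b1 b), forall u, c <= VaR u X} ->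
  c * (b - a) <= \int[mu]_(u in [set` Interval (BSide b0 a) (BSide b1 b)]) VaR u X.
Proof.
move=> ab ab01 cV.
have -> : c * (b - a) =
    \int[mu]_(u in [set` Interval (BSide b0 a) (BSide b1 b)]) c.
  by rewrite Rintegral_cst//= lebesgue_measure_itv/= lte_fin ab.
apply: le_Rintegral => //; first exact: integrable_cst_itv.
exact: integrable_VaR.
Qed.

(** The stop-loss transform of [X] at the retention [t]. *)
Definition excess (t : R) : R := \int[P]_w Num.max (X w - t) 0.

Lemma excessE (t : R) :
  excess t = \int[mu]_(a in `]0, 1[) Num.max (VaR a X - t) 0.
Proof.
rewrite /excess /Rintegral; congr fine.
apply: (@ge0_integral_VaR (fun y => (Num.max (y - t) 0)%:E)).
  apply/measurable_EFinP; apply: measurable_maxr => //.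
  exact: measurable_funB.
by move=> y; rewrite lee_fin le_max lexx orbT.
Qed.

Let integrable_VaR_excess (t : R) :
  mu.-integrable `]0, 1[%classic (fun a => (Num.max (VaR a X - t) 0)%:E).
Proof.
have mD : measurable (`]0, 1[%classic : set (measurableTypeR R)) by [].
have iB := integrableB mD integrable_VaR01 (integrable_cst_itv 0 1 t false true).
exact: (@integrable_funrpos _ _ _ mu _ (fun a => VaR a X - t) mD iB).
Qed.

(** Pointwise [v <= t + max (v - t) 0]; the nonnegative second term may then be integrated over the
    whole unit interval. This is the inequality half of the representation of Expected Shortfall as
    a minimum over [t]. *)
Lemma Rintegral_VaR_le_excess (p t : R) : 0 < p < 1 ->
  \int[mu]_(a in `]p, 1[) VaR a X <= t * (1 - p) + excess t.
Proof.
move=> /andP[p0 p1].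
have mg : mu.-integrable `]p, 1[%classic
    (fun a => (Num.max (VaR a X - t) 0)%:E).
  by apply: integrableS (integrable_VaR_excess t) => //; exact: sub01.
have -> : t * (1 - p) = \int[mu]_(u in `]p, 1[) t.
  by rewrite Rintegral_cst//= lebesgue_measure_itv/= lte_fin p1.
rewrite excessE.
apply: (@le_trans _ _ (\int[mu]_(u in `]p, 1[) t +
    \int[mu]_(a in `]p, 1[) Num.max (VaR a X - t) 0)).
  rewrite -RintegralD//; last exact: integrable_cst_itv.
  apply: le_Rintegral => //.
  - by apply: integrable_VaR => //; exact: sub01.
  - have mA : measurable (`]p, 1[%classic : set (measurableTypeR R)) by [].
    exact: (integrableD mA (integrable_cst_itv p 1 t false true) mg).
  - by move=> a _; rewrite -lerBlDl le_max lexx.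
rewrite lerD2l /Rintegral fine_le//; try exact: integrable_fin_num.
apply: ge0_subset_integral => //; last exact: sub01.
  exact: measurable_int (integrable_VaR_excess t).
by move=> a _; rewrite lee_fin le_max lexx orbT.
Qed.

(** The minimum is reached at [t = VaR p X]: by monotonicity the positive part vanishes up to level
    [p] and equals [VaR a X - t] beyond it. *)
Lemma Rintegral_VaR_excess (p : R) : 0 < p < 1 ->
  \int[mu]_(a in `]p, 1[) VaR a X = VaR p X * (1 - p) + excess (VaR p X).
Proof.
move=> /andP[p0 p1]; set t := VaR p X.
have -> : t * (1 - p) = \int[mu]_(u in `]p, 1[) t.
  by rewrite Rintegral_cst//= lebesgue_measure_itv/= lte_fin p1.
have -> : excess t = \int[mu]_(a in `]p, 1[) (VaR a X - t).
  have itvU : `]0, 1[%classic = `]0, p]%classic `|` `]p, 1[%classic :> set R.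
    by rewrite -itv_bndbnd_setU// bnd_simp ltW.
  rewrite excessE itvU Rintegral_setU//=; last 2 first.
    by rewrite -itvU; exact: integrable_VaR_excess.
    apply/disj_set2P; rewrite -subset0 => z/=; rewrite !in_itv/= => -[/andP[_]].
    by rewrite leNgt => /negbTE ->.
  rewrite [X in X + _](_ : _ = 0) ?add0r.
    apply: eq_Rintegral => a; rewrite inE/= in_itv/= => /andP[pa a1].
    by rewrite max_l// subr_ge0 VaR_nondecreasing// ltW.
  rewrite /Rintegral integral0_eq// => a /=; rewrite in_itv/= => /andP[a0 ap].
  by rewrite max_r// subr_le0 VaR_nondecreasing.
rewrite RintegralB//; last exact: integrable_cst_itv.
  by rewrite subrKC.
by apply: integrable_VaR => //; exact: sub01.
Qed.

End quantile_integral.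

(** * Invariance under equality in law, and subadditivity of the excess *)

Section equal_law.
Context (d : measure_display) (T : measurableType d) (R : realType).
Variables (P : probability T R) (F : probability R R).

Lemma ge0_integral_has_law (X Y : {RV P >-> R}) (f : R -> \bar R) :
  has_law X F -> has_law Y F ->
  measurable_fun setT f -> (forall y, (0 <= f y)%E) ->
  (\int[P]_w f (X w) = \int[P]_w f (Y w))%E.
Proof.
move=> XF YF mf f0.
rewrite -(ge0_integral_distribution X)// -(ge0_integral_distribution Y)//.
by apply: eq_measure_integral => A mA _; rewrite [LHS]XF// [RHS]YF.
Qed.

Lemma integrable_has_law (X Y : {RV P >-> R}) :
  has_law X F -> has_law Y F ->
  P.-integrable setT (EFin \o X) -> P.-integrable setT (EFin \o Y).
Proof.
move=> XF YF /integrableP[_ iX]; apply/integrableP; split.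
  by apply/measurable_EFinP.
move: iX; rewrite (ge0_integral_has_law (f := fun y => `|y%:E|%E) XF YF)//.
by do 2 apply: measurableT_comp => //.
Qed.

Lemma excess_has_law (X Y : {RV P >-> R}) (t : R) :
  has_law X F -> has_law Y F -> excess X t = excess Y t.
Proof.
move=> XF YF; congr fine.
apply: (ge0_integral_has_law (f := fun y => (Num.max (y - t) 0)%:E) XF YF).
  apply/measurable_EFinP; apply: measurable_maxr => //.
  exact: measurable_funB.
by move=> y; rewrite lee_fin le_max lexx orbT.
Qed.

Lemma sums_intro (n : nat) (X : 'I_n -> {RV P >-> R}) :
  (forall i, has_law (X i) F) ->
  exists2 S : {RV P >-> R}, sums F n S & forall w, S w = \sum_(i < n) X i w.
Proof.
move=> XF.
have mS : (fun w => \sum_(i < n) X i w) \in mfun.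
  by rewrite inE; exact: measurable_sum.
exists (mfun_Sub mS : {RV P >-> R}); last by [].
by exists X.
Qed.

End equal_law.

Lemma Rintegral_sum (d : measure_display) (T : measurableType d) (R : realType)
    (mu : {measure set T -> \bar R}) (D : set T) (n : nat)
    (f : 'I_n -> T -> R) :
  measurable D -> (forall i, mu.-integrable D (EFin \o f i)) ->
  \int[mu]_(x in D) (\sum_(i < n) f i x) = \sum_(i < n) \int[mu]_(x in D) f i x.
Proof.
move=> mD fi; rewrite /Rintegral.
under eq_integral do rewrite -sumEFin.
rewrite integral_sum// sum_fine// => i _.
by have := integrable_fin_num mD (fi i).
Qed.

Section excess_facts.
Context (d : measure_display) (T : measurableType d) (R : realType).
Variable P : probability T R.

Lemma integrable_excess (X : {RV P >-> R}) (t : R) :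
  P.-integrable setT (EFin \o X) ->
  P.-integrable setT (fun w => (Num.max (X w - t) 0)%:E).
Proof.
move=> iX.
have iB := integrableB measurableT iX
  (finite_measure_integrable_cst P t measurableT).
exact: (@integrable_funrpos _ _ _ P _ (fun w => X w - t) measurableT iB).
Qed.

(** The positive part is subadditive, whatever the dependence between the summands. *)
Lemma excess_sum (n : nat) (X : 'I_n -> {RV P >-> R}) (S : {RV P >-> R})
    (t : 'I_n -> R) :
  (forall i, P.-integrable setT (EFin \o X i)) ->
  P.-integrable setT (EFin \o S) ->
  (forall w, S w = \sum_(i < n) X i w) ->
  excess S (\sum_(i < n) t i) <= \sum_(i < n) excess (X i) (t i).
Proof.
move=> iX iS SE; rewrite /excess -Rintegral_sum//; last first.
  by move=> i; exact: integrable_excess.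
apply: le_Rintegral => //.
- exact: integrable_excess.
- rewrite [X in integrable _ _ X](_ : _ =
    fun w => (\sum_(i < n) (Num.max (X i w - t i) 0)%:E)%E); last first.
    by apply/funext => w; rewrite sumEFin.
  by apply: integrable_sum => // i _; exact: integrable_excess.
- move=> w _; rewrite SE -sumrB ge_max; apply/andP; split.
    by apply: ler_sum => i _; rewrite le_max lexx.
  by apply: sumr_ge0 => i _; rewrite le_max lexx orbT.
Qed.

End excess_facts.

(** * The supremum of ES, and an upper bound on the supremum of VaR *)

Section upper_bounds.
Context (d : measure_display) (T : measurableType d) (R : realType).
Variables (P : probability T R) (F : probability R R) (X : {RV P >-> R}).
Hypotheses (XF : has_law X F) (iX : P.-integrable setT (EFin \o X)).
Variable p : R.
Hypothesis p01 : 0 < p < 1.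
Local Notation mu := (@lebesgue_measure R).

Lemma integrable_sums (n : nat) (S : {RV P >-> R}) :
  sums F n S -> P.-integrable setT (EFin \o S).
Proof.
move=> [Y YF SE].
rewrite (_ : EFin \o S = fun w => (\sum_(i < n) (Y i w)%:E)%E); last first.
  by apply/funext => w; rewrite /= SE sumEFin.
by apply: integrable_sum => // i _; exact: integrable_has_law XF (YF i) iX.
Qed.

Lemma VaR_le_Rintegral (S : {RV P >-> R}) : P.-integrable setT (EFin \o S) ->
  VaR p S * (1 - p) <= \int[mu]_(a in `]p, 1[) VaR a S.
Proof.
move: p01 => /andP[p0 p1] iS; apply: Rintegral_VaR_ge => //.
  by apply: subset_itvr; rewrite bnd_simp ltW.
by move=> u; rewrite in_itv/= => /andP[pu u1]; rewrite VaR_nondecreasing// ltW.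
Qed.

Lemma Rintegral_VaR_sums (n : nat) (S : {RV P >-> R}) : sums F n S ->
  \int[mu]_(a in `]p, 1[) VaR a S <= n%:R * \int[mu]_(a in `]p, 1[) VaR a X.
Proof.
move=> FS; have iS := integrable_sums FS; case: FS => Y YF SE.
have iY i : P.-integrable setT (EFin \o Y i).
  exact: integrable_has_law XF (YF i) iX.
(* All thresholds are [VaR p X], so that each summand has the excess for which
   [Rintegral_VaR_excess] is an equality. *)
have := excess_sum (fun=> VaR p X) iY iS SE.
rewrite [leRHS](eq_bigr (fun=> excess X (VaR p X))); last first.
  by move=> i _; exact: excess_has_law (YF i) XF.
rewrite !sumr_const card_ord -[_ *+ n]mulr_natl -[excess _ _ *+ n]mulr_natl.
rewrite (Rintegral_VaR_excess iX p01) => ub.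
apply: (le_trans (Rintegral_VaR_le_excess iS (n%:R * VaR p X) p01)).
by rewrite [leRHS]mulrDr mulrA lerD2l.
Qed.

Lemma VaR_natmul (n : nat) (S : {RV P >-> R}) (a : R) : (0 < n)%N ->
  0 < a < 1 -> (forall w, S w = n%:R * X w) -> VaR a S = n%:R * VaR a X.
Proof.
move=> n0 a01 SE; have n0' : 0 < n%:R :> R by rewrite ltr0n.
have cdfS x : cdf S x = cdf X (n%:R^-1 * x).
  rewrite /cdf /distribution /pushforward; congr (P _).
  by apply/seteqP; split => w /=; rewrite !in_itv/= SE ler_pdivlMl.
have le_iff x : (VaR a S <= x) = (n%:R * VaR a X <= x).
  by rewrite VaR_le// cdfS -VaR_le// ler_pdivlMl.
by apply/le_anti; rewrite le_iff lexx -le_iff lexx.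
Qed.

Local Notation es := ((1 - p)^-1 * \int[mu]_(a in `]p, 1[) VaR a X).

(** The bound of [Rintegral_VaR_sums] is attained when all summands are the same variable [X]. *)
Lemma sup_ESE (n : nat) : (0 < n)%N -> sup_ES P p F n = (n%:R * es)%:E.
Proof.
move=> n0; have [p0 p1] := andP p01.
apply/le_anti/andP; split.
  apply: ge_ereal_sup => _ [S FS <-].
  rewrite (ESE (integrable_sums FS))// lee_fin mulrCA ler_wpM2l//.
    by rewrite invr_ge0 subr_ge0 ltW.
  exact: Rintegral_VaR_sums.
have [S FS SE] := sums_intro (fun _ : 'I_n => XF).
have SE' w : S w = n%:R * X w.
  by rewrite SE sumr_const card_ord mulr_natl.
apply: le_ereal_sup_tmp; exists (ES p S); first by exists S.
rewrite (ESE (integrable_sums FS))// lee_fin mulrCA ler_wpM2l//.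
  by rewrite invr_ge0 subr_ge0 ltW.
rewrite -RintegralZl//; last first.
  by apply: integrable_VaR => //; apply: subset_itvr; rewrite bnd_simp ltW.
rewrite le_eqVlt; apply/orP; left; apply/eqP; apply: eq_Rintegral => a.
rewrite inE/= in_itv/= => /andP[pa a1].
by rewrite (VaR_natmul n0 _ SE')// (lt_trans p0).
Qed.

Lemma sup_VaR_le (n : nat) : (sup_VaR P p F n <= (n%:R * es)%:E)%E.
Proof.
have [p0 p1] := andP p01.
apply: ge_ereal_sup => _ [S FS <-].
rewrite lee_fin mulrCA ler_pdivlMl ?subr_gt0// mulrC.
by rewrite (le_trans (VaR_le_Rintegral (integrable_sums FS)))// Rintegral_VaR_sums.
Qed.

End upper_bounds.

(** * A uniform variable and rotations that preserve its law *)

Section uniform_variable.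
Context (d : measure_display) (T : measurableType d) (R : realType).
Variable P : probability T R.
Local Notation nu := (uniform_prob (@ltr01 R)).

(** The hypothesis concerns laws of tuples, so the uniform law is carried to 1-tuples, one vector is
    generated, and its only coordinate is read off. *)
Lemma exists_unit_uniform : generates_independent_vectors P ->
  exists U : {RV P >-> R}, forall A : set R, measurable A ->
    distribution P U A = nu A.
Proof.
move=> P_rich.
have mg : ((fun x : R => [tuple x]) : measurableTypeR R -> 1.-tuple R) \in mfun.
  rewrite inE; apply/measurable_fun_tnthP => i.
  by rewrite (_ : _ \o _ = id)//; apply/funext => x; rewrite /= (tnth_nth x) ord1.
have [V Vlaw _] := P_rich 1%N (fun=> 1%N) (fun=> distribution nu (mfun_Sub mg)).
have mU : ((fun w => tnth (V ord0 w) ord0) : T -> R) \in mfun.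
  rewrite inE.
  exact: (measurableT_comp (measurable_tnth ord0) (measurable_funPT (V ord0))).
exists (mfun_Sub mU) => A mA.
have := Vlaw ord0 ((fun t : 1.-tuple R => tnth t ord0) @^-1` A).
apply.
rewrite -[X in measurable X]setTI; exact: (measurable_tnth ord0).
Qed.

End uniform_variable.

Section block_swap.
Context (R : realType).
Local Notation mu := (@lebesgue_measure R).
Local Notation nu := (uniform_prob (@ltr01 R)).
Variables q s : R.

(** Rotation of the part above [q] by [s], modulo its length [1 - q]. The point [1 - s] goes to [q]
    itself, hence the weak lower bound in [block_swap_bounds]. *)
Definition block_swap (u : R) : R :=
  if u <= q then u else if u + s < 1 then u + s else u + s - (1 - q).

Lemma measurable_block_swap : measurable_fun setT block_swap.
Proof.
apply: measurable_fun_ifT => //.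
  by apply: measurable_fun_ler.
apply: measurable_fun_ifT => //.
- by apply: measurable_fun_ltr => //; exact: measurable_funD.
- exact: measurable_funD.
- by apply: measurable_funB => //; exact: measurable_funD.
Qed.

Hypotheses (q0 : 0 < q) (s0 : 0 <= s) (s1 : s < 1 - q).

Lemma block_swap_bounds (u : R) : q < u -> u < 1 -> q <= block_swap u < 1.
Proof.
move: s0 s1 => s_ge0 s_lt qu u1; rewrite /block_swap.
by case: (leP u q) => ?; [|case: (ltP (u + s) 1) => ?]; lra.
Qed.

Let mu_itv (a b : R) (c1 c2 : bool) : a <= b ->
  mu [set` Interval (BSide c1 a) (BSide c2 b)] = (b - a)%:E.
Proof.
rewrite le_eqVlt lebesgue_measure_itv/= lte_fin => /predU1P[->|->//].
by rewrite ltxx subrr.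
Qed.

Lemma block_swap_law (A : set R) : measurable A ->
  nu (block_swap @^-1` A) = nu A.
Proof.
have mf : (block_swap : measurableTypeR R -> R) \in mfun.
  by rewrite inE; exact: measurable_block_swap.
have mid : (idfun : measurableTypeR R -> R) \in mfun.
  by rewrite inE; exact: measurable_id.
move: q0 s0 s1 => q_gt0 s_ge0 s_lt mA.
rewrite -[LHS]/(distribution nu (mfun_Sub mf) A).
rewrite -[RHS]/(distribution nu (mfun_Sub mid) A).
apply: eq_probability_itvNyc => // x.
rewrite -[LHS]/(nu (block_swap @^-1` `]-oo, x]%classic)).
rewrite -[RHS]/(nu `]-oo, x]%classic).
rewrite !unit_uniformE//; last first.
  by rewrite -[X in measurable X]setTI; exact: measurable_block_swap.
(* Below [q] the map is the identity, and no point above [q] is sent there. *)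
have [xq|qx] := ltP x q.
  congr (mu _); apply/seteqP; split => u /=; rewrite !in_itv/= /block_swap;
    case: ifPn => uq; try (by move=> [? ?]; split); move: uq; rewrite -ltNge => uq.
    by case: ifPn => us [? /andP[? ?]]; exfalso; move: us; rewrite -?leNgt; lra.
  by move=> [? ?]; exfalso; lra.
have [x1|x1] := leP 1 x.
  congr (mu _); apply/seteqP; split => u /=; rewrite !in_itv/= => -[ux u01];
    split => //; first lra.
  have [uq|qu] := leP u q; first by rewrite /block_swap uq; lra.
  have [_ u1] := andP u01.
  by have := block_swap_bounds qu u1; lra.
have -> : `]-oo, x] `&` `]0, 1[ = `]0, x]%classic :> set R.
  by apply/seteqP; split => u /=; rewrite !in_itv/= => H; lra.
(* For [x < q + s], only the fixed part and an initial piece of the wrapped part [[1 - s, 1[] are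
   sent below [x]; the lengths are [q] and [x - q]. *)
have [xqs|qsx] := ltP x (q + s).
  have -> : block_swap @^-1` `]-oo, x] `&` `]0, 1[ =
      `]0, q]%classic `|` `[1 - s, x + 1 - q - s]%classic :> set R.
    apply/seteqP; split => u /=; rewrite !in_itv/= /block_swap.
      case: (leP u q) => uq; first by move=> [_ /andP[u0 u1]]; left; rewrite u0.
      by case: (ltP (u + s) 1) => us [ux /andP[u0 u1]]; right; lra.
    move=> [/andP[u0 uq]|/andP[us ux]]; first by rewrite uq u0/=; lra.
    have -> : (u <= q) = false by apply/negbTE; rewrite -ltNge; lra.
    have -> : (u + s < 1) = false by apply/negbTE; rewrite -leNgt; lra.
    by split; lra.
  rewrite measureU//; last first.
    by rewrite -subset0 => u /=; rewrite !in_itv/= => -[? ?]; lra.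
  have E1 := mu_itv false false (ltW q0).
  have /(mu_itv true false) E2 : 1 - s <= x + 1 - q - s by lra.
  have /(mu_itv false false) E3 : 0 <= x by lra.
  apply: (@eq_trans _ _ ((q - 0)%:E + (x + 1 - q - s - (1 - s))%:E)%E).
    by rewrite -E1 -E2.
  by rewrite E3 -EFinD; congr EFin; lra.
(* Now the whole wrapped part counts, with length [s], and the fixed and merely shifted points merge
   into an interval of length [x - s]. *)
have -> : block_swap @^-1` `]-oo, x] `&` `]0, 1[ =
    `]0, x - s]%classic `|` `[1 - s, 1[%classic :> set R.
  apply/seteqP; split => u /=; rewrite !in_itv/= /block_swap.
    case: (leP u q) => uq; first by move=> [_ /andP[u0 u1]]; left; lra.
    by case: (ltP (u + s) 1) => us [ux /andP[u0 u1]]; [left|right]; lra.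
  move=> [/andP[u0 uq]|/andP[us ux]].
    case: (leP u q) => uq'; first by split; lra.
    by case: (ltP (u + s) 1) => us; split; lra.
  have -> : (u <= q) = false by apply/negbTE; rewrite -ltNge; lra.
  have -> : (u + s < 1) = false by apply/negbTE; rewrite -leNgt; lra.
  by split; lra.
rewrite measureU//; last first.
  by rewrite -subset0 => u /=; rewrite !in_itv/= => -[? ?]; lra.
have /(mu_itv false false) E1 : 0 <= x - s by lra.
have /(mu_itv true true) E2 : 1 - s <= 1 by lra.
have /(mu_itv false false) E3 : 0 <= x by lra.
apply: (@eq_trans _ _ ((x - s - 0)%:E + (1 - (1 - s))%:E)%E).
  by rewrite -E1 -E2.
by rewrite E3 -EFinD; congr EFin; lra.
Qed.

End block_swap.

(** * Lower bound on the supremum of VaR *)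

Section lower_bound.
Context (d : measure_display) (T : measurableType d) (R : realType).
Variables (P : probability T R) (F : probability R R) (X : {RV P >-> R}).
Local Notation mu := (@lebesgue_measure R).

(** The event [q < U < 1] has probability [1 - q], so for [x < L] the distribution function of [S]
    at [x] is at most [q < p]. *)
Lemma ge_VaR (S U : {RV P >-> R}) (p q L : R) : 0 < p < 1 -> 0 < q -> q < p ->
  (forall A : set R, measurable A ->
    distribution P U A = uniform_prob (@ltr01 R) A) ->
  (forall w, q < U w < 1 -> L <= S w) -> L <= VaR p S.
Proof.
move=> p01 q0 qp Ulaw LS; have [p0 p1] := andP p01.
apply: lb_le_inf; first exact: (has_inf_VaR S p01).1.
move=> x /= px; rewrite leNgt; apply/negP => xL.
suff : (cdf S x <= q%:E)%E.
  by move=> /(le_trans px); rewrite lee_fin leNgt qp.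
have mV : measurable (U @^-1` `]q, 1[%classic).
  by rewrite -[X in measurable X]setTI; exact: (measurable_funPT U).
have PV : P (U @^-1` `]q, 1[%classic) = (1 - q)%:E.
  rewrite -[LHS]/(distribution P U `]q, 1[%classic) Ulaw// unit_uniformE//.
  rewrite setIidl; last by apply: subset_itvr; rewrite bnd_simp ltW.
  by rewrite lebesgue_measure_itv/= lte_fin (lt_trans qp).
have -> : q%:E = P (~` (U @^-1` `]q, 1[%classic)).
  by rewrite probability_setC// PV -EFinB; congr EFin; ring.
rewrite -[leLHS]/(P (S @^-1` `]-oo, x]%classic)).
apply: le_measure; rewrite ?inE.
- by rewrite -[X in measurable X]setTI; exact: (measurable_funPT S).
- exact: measurableC.
- move=> w /=; rewrite in_itv/= => Sx; rewrite in_itv/= => /LS LSw.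
  by move: (le_lt_trans Sx xL); rewrite ltNge LSw.
Qed.

Lemma sum_quantile_block_swap (N : nat) (q w u : R) :
  0 < q -> 0 < w -> N.+1%:R * w = 1 - q -> q < u < 1 ->
  \sum_(i < N.+1) VaR (q + i%:R * w) X <=
  \sum_(i < N.+1) quantile X (block_swap q (i%:R * w) u).
Proof.
move=> q0 w0 Nw /andP[qu u1].
have uqw0 : 0 <= (u - q) / w by rewrite divr_ge0// ?subr_ge0 ltW.
(* The index of the cell containing [u]. *)
pose m := Num.truncn ((u - q) / w).
have mlb : m%:R * w <= u - q by rewrite -ler_pdivlMr// truncn_le.
have mub : u - q < m.+1%:R * w by rewrite -ltr_pdivrMr// truncnS_gt.
have mN : (m < N.+1)%N.
  rewrite -(ltr_nat R) -(ltr_pM2r w0) Nw; lra.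
(* Addition in ['I_N.+1] is modulo [N.+1]: rotation by [i] cells moves [u] from cell [m] to cell
   [m + i], whose left end bounds the new point from below. The two cases below are no wrap and one
   wrap. *)
rewrite (reindex_inj (addrI (inord m : 'I_N.+1)))/=.
apply: ler_sum => i _.
have iw0 : 0 <= i%:R * w by rewrite mulr_ge0// ltW.
have iw1 : i%:R * w < 1 - q by rewrite -Nw ltr_pM2r// ltr_nat.
have /andP[b0 b1] := block_swap_bounds iw0 iw1 qu u1.
rewrite quantileE ?b1 ?(lt_le_trans q0 b0)//.
apply: VaR_nondecreasing => //.
  by rewrite ltr_wpDr// mulr_ge0// ltW.
rewrite inordK// /block_swap [u <= q]leNgt qu/=.
have [us|us] := ltP (u + i%:R * w) 1.
  have mi : (m + i < N.+1)%N.
    rewrite -(ltr_nat R) -(ltr_pM2r w0) Nw natrD mulrDl; lra.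
  by rewrite modn_small// natrD mulrDl; lra.
have mi : (N.+1 <= m + i)%N.
  rewrite -ltnS -addSn -(ltr_nat R) -(ltr_pM2r w0) Nw natrD mulrDl; lra.
have -> : ((m + i) %% N.+1 = m + i - N.+1)%N.
  rewrite -[in LHS](subnK mi) modnDr modn_small//.
  by rewrite ltn_subLR// -addSn leq_add// ltnW.
by rewrite natrB// natrD mulrBl mulrDl Nw; lra.
Qed.

Hypotheses (XF : has_law X F) (iX : P.-integrable setT (EFin \o X)).

(** On each cell the quantile is at most its value at the right end. The last right end stays below
    1, within the domain of monotonicity. *)
Lemma Rintegral_VaR_le_riemann (p w : R) (m : nat) : 0 < p -> 0 < w ->
  p + m%:R * w < 1 ->
  \int[mu]_(a in `]p, (p + m%:R * w)%R]) VaR a X <=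
  w * \sum_(i < m) VaR (p + i.+1%:R * w) X.
Proof.
move=> p0 w0; elim: m => [_|m IHm pm1].
  by rewrite mul0r addr0 set_itv_ge ?Rintegral_set0 ?big_ord0 ?mulr0// bnd_simp ltxx.
have mw : m%:R * w <= m.+1%:R * w by rewrite ler_pM2r// ler_nat.
have m0 : 0 <= m%:R * w by rewrite mulr_ge0// ltW.
have mS : m.+1%:R * w = m%:R * w + w by rewrite -natr1 mulrDl mul1r.
have itvU : `]p, (p + m.+1%:R * w)]%classic =
    `]p, (p + m%:R * w)]%classic `|` `](p + m%:R * w), (p + m.+1%:R * w)]%classic
    :> set R.
  by rewrite -itv_bndbnd_setU// bnd_simp; lra.
have sub a b : p <= a -> b <= p + m.+1%:R * w ->
    `]a, b]%classic `<=` (`]0, 1[%classic : set R).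
  by move=> pa bm; apply: subset_itv; rewrite bnd_simp; lra.
rewrite itvU Rintegral_setU//=; last 2 first.
- by rewrite -itvU; apply: integrable_VaR => //; exact: sub.
- apply/disj_set2P; rewrite -subset0 => z/=; rewrite !in_itv/= => -[/andP[_]].
  by rewrite leNgt => /negbTE ->.
rewrite big_ord_recr/= mulrDr lerD ?IHm//; first lra.
have -> : w * VaR (p + m.+1%:R * w) X =
    \int[mu]_(u in `](p + m%:R * w), (p + m.+1%:R * w)]) VaR (p + m.+1%:R * w) X.
  rewrite Rintegral_cst//= lebesgue_measure_itv/= lte_fin mulrC; congr (_ * _).
  by rewrite ifT/=; lra.
apply: le_Rintegral => //.
- by apply: integrable_VaR => //; apply: sub; lra.
- exact: integrable_cst_itv.
- by move=> a /=; rewrite in_itv/= => /andP[pa am]; rewrite VaR_nondecreasing//; lra.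
Qed.

Lemma sup_VaR_ge (p w : R) (M : nat) : generates_independent_vectors P ->
  0 < p < 1 -> 0 < w -> w < p -> M.+1%:R * w = 1 - p ->
  ((VaR (p - w) X + VaR p X +
    w^-1 * \int[mu]_(a in `]p, (1 - w)%R]) VaR a X)%:E <=
   sup_VaR P p F M.+2)%E.
Proof.
move=> P_rich p01 w0 wp Mw; have [p0 p1] := andP p01.
have [U Ulaw] := exists_unit_uniform P_rich.
have q0 : 0 < p - w by rewrite subr_gt0.
(* The [M.+2] cells start one width below [p], so that the event on which the sum is controlled has
   probability greater than [1 - p]. *)
have Nw : M.+2%:R * w = 1 - (p - w) by rewrite -natr1 mulrDl mul1r Mw; ring.
pose Y (i : 'I_M.+2) w' := quantile X (block_swap (p - w) (i%:R * w) (U w')).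
have mY i : Y i \in mfun.
  rewrite inE; apply: (measurableT_comp (measurable_quantile X)).
  exact: (measurableT_comp (measurable_block_swap _ _) (measurable_funPT U)).
have YF i : has_law (mfun_Sub (mY i) : {RV P >-> R}) F.
  move=> A mA; rewrite -XF//.
  have iw0 : 0 <= i%:R * w by rewrite mulr_ge0// ltW.
  have iw1 : i%:R * w < 1 - (p - w) by rewrite -Nw ltr_pM2r// ltr_nat.
  have mqA : measurable (quantile X @^-1` A).
    by rewrite -[Z in measurable Z]setTI; exact: measurable_quantile.
  have mbA : measurable (block_swap (p - w) (i%:R * w) @^-1` (quantile X @^-1` A)).
    by rewrite -[Z in measurable Z]setTI; exact: measurable_block_swap.
  apply: etrans (quantile_law X mA).
  apply: etrans (block_swap_law q0 iw0 iw1 mqA).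
  exact: Ulaw mbA.
have [S FS SE] := sums_intro YF.
apply: le_ereal_sup_tmp; exists (VaR p S)%:E; first by exists S.
rewrite lee_fin.
apply: (ge_VaR p01 q0 _ Ulaw) => [|w' Uw']; first by rewrite gtrBl.
rewrite SE; apply: le_trans (sum_quantile_block_swap q0 w0 Nw Uw').
(* The left ends [p - w] and [p] are split off; the others, [p + w] to [p + M * w = 1 - w], are the
   right ends of a Riemann sum over []p, 1 - w]]. *)
rewrite 2!big_ord_recl/= mul0r addr0 mul1r subrK -addrA lerD2l lerD2l.
rewrite mulrC ler_pdivrMr// mulrC.
have <- : p + M%:R * w = 1 - w.
  by move: Mw; rewrite -natr1 mulrDl mul1r; lra.
rewrite (eq_bigr (fun i : 'I_M => VaR (p + i.+1%:R * w) X)); last first.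
  move=> i _; congr (VaR _ X).
  by rewrite /bump/= !add1n -[in LHS]natr1 mulrDl mul1r; ring.
apply: Rintegral_VaR_le_riemann => //.
by move: Mw; rewrite -natr1 mulrDl mul1r; lra.
Qed.

End lower_bound.

(** * The quantile tail under a moment condition *)

(** For [y > c], write [y] as [y^(1-k) * y^k]; the exponent [1 - k] is nonpositive, so the first
    factor is at most [c^(1-k)]. *)
Lemma le_cst_powR (R : realType) (k c y : R) : 1 <= k -> 0 < c ->
  y <= c + c `^ (1 - k) * `|y| `^ k.
Proof.
move=> k1 c0; have [yc|cy] := leP y c.
  by rewrite ler_wpDr// mulr_ge0// powR_ge0.
have y0 : 0 < y by rewrite (lt_trans c0).
apply: ler_wpDl; first exact: ltW.
rewrite gtr0_norm// -(mulr_powRB1 (ltW y0) (lt_le_trans ltr01 k1)).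
rewrite mulrCA -[leLHS]mulr1 ler_pM2l// -opprB powRN.
rewrite mulrC ler_pdivlMr ?powR_gt0// mul1r.
by apply: ge0_ler_powR; rewrite ?subr_ge0// ?nnegrE ltW.
Qed.

Lemma powR_natr_ge (R : realType) (k c : R) : 0 < k ->
  \forall n \near \oo, c <= (n%:R : R) `^ k^-1.
Proof.
move=> k0; have : \forall n \near \oo, (`|c| `^ k : R) <= n%:R.
  exact: nbhs_infty_ger.
apply: filterS => n cn; rewrite (le_trans (ler_norm c))//.
have -> : `|c| = (`|c| `^ k) `^ k^-1.
  by rewrite -powRrM mulfV ?gt_eqF// powRr1.
by apply: ge0_ler_powR; rewrite ?nnegrE ?powR_ge0 ?invr_ge0 ?(ltW k0).
Qed.

Section moment.
Context (d : measure_display) (T : measurableType d) (R : realType).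
Variables (P : probability T R) (X : {RV P >-> R}) (k : R).
Hypotheses (k1 : 1 <= k)
  (X_moment : ('E_P[fun w => (`|X w| `^ k)%R] < +oo)%E).
Local Notation mu := (@lebesgue_measure R).

Lemma moment_integrable : P.-integrable setT (EFin \o X).
Proof.
have iXk : P.-integrable setT (fun w => (`|X w| `^ k)%:E).
  apply/integrableP; split.
    apply/measurable_EFinP; apply: (measurableT_comp (measurable_powR k)).
    by apply: measurableT_comp.
  under eq_integral do rewrite gee0_abs ?lee_fin ?powR_ge0//.
  by move: X_moment; rewrite unlock.
have i1 := finite_measure_integrable_cst P (1 : R) measurableT.
have := integrableD measurableT i1 iXk.
apply: le_integrable => //; first exact/measurable_EFinP.
move=> w _ /=; rewrite lee_fin.
(* With threshold 1 this reads [|x| <= 1 + |x|^k]. *)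
have := le_cst_powR `|X w| k1 ltr01; rewrite powR1 mul1r normr_id => /le_trans.
by apply; rewrite ler_norm.
Qed.

Lemma integrable_VaR_powR :
  mu.-integrable `]0%R, 1%R[ (fun a => (`|VaR a X| `^ k)%:E).
Proof.
apply/integrableP; split.
  apply/measurable_EFinP; apply: (measurableT_comp (measurable_powR k)).
  by apply: measurableT_comp => //; exact: measurable_VaR.
under eq_integral do rewrite gee0_abs ?lee_fin ?powR_ge0//.
rewrite -(@ge0_integral_VaR _ _ _ _ _ (fun y => (`|y| `^ k)%:E)).
- by move: X_moment; rewrite unlock.
- apply/measurable_EFinP; apply: (measurableT_comp (measurable_powR k)).
  exact: normr_measurable.
- by move=> y; rewrite lee_fin powR_ge0.
Qed.

(** Absolute continuity of the integral of the k-th power, whose total mass is the k-th moment. *)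
Lemma Rintegral_VaR_powR_tail (e : R) : 0 < e ->
  exists2 r : R, 0 < r & forall w, 0 < w -> w < r -> w < 1 ->
    \int[mu]_(a in `](1 - w)%R, 1[) (`|VaR a X| `^ k) < e.
Proof.
move=> e0.
pose f := (fun a : measurableTypeR R => `|VaR a X| `^ k) \_ `]0, 1[.
have intf : mu.-integrable setT (EFin \o f).
  rewrite /f -restrict_EFin.
  by apply: (integrable_mkcond _ _).1 => //; have := integrable_VaR_powR.
have [r [r0 fr]] := integral_normr_continuous intf e0.
exists r => // w w0 wr w1.
have -> : \int[mu]_(a in `](1 - w)%R, 1[) (`|VaR a X| `^ k) =
    \int[mu]_(a in `](1 - w)%R, 1[) `|f a|.
  apply: eq_Rintegral => a; rewrite inE/= in_itv/= => /andP[wa a1].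
  rewrite /f patchE mem_set; last by rewrite /= in_itv/=; lra.
  by rewrite [RHS]ger0_norm// powR_ge0.
have muw : mu `](1 - w)%R, 1[%classic = w%:E.
  rewrite lebesgue_measure_itv/= lte_fin ifT; first by rewrite -EFinB subKr.
  by lra.
by apply: fr => //; move: wr; rewrite -lte_fin -muw.
Qed.

Lemma Rintegral_VaR_tail_le (w c : R) : 0 < w -> w < 1 -> 0 < c ->
  \int[mu]_(a in `](1 - w)%R, 1[) VaR a X <=
  c * w + c `^ (1 - k) * \int[mu]_(a in `](1 - w)%R, 1[) (`|VaR a X| `^ k).
Proof.
move=> w0 w1 c0.
have sub : `](1 - w)%R, 1[%classic `<=` (`]0, 1[%classic : set R).
  by apply: subset_itvr; rewrite bnd_simp; lra.
have mD : measurable (`](1 - w)%R, 1[%classic : set (measurableTypeR R)) by [].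
have iV := integrable_VaR moment_integrable mD sub.
have iVk : mu.-integrable `](1 - w)%R, 1[ (fun a => (`|VaR a X| `^ k)%:E).
  by apply: integrableS integrable_VaR_powR.
have -> : c * w = \int[mu]_(a in `](1 - w)%R, 1[) c.
  rewrite Rintegral_cst//= lebesgue_measure_itv/= lte_fin.
  by rewrite ifT/=; [congr (_ * _)|]; lra.
have icVk := integrableZl mD (c `^ (1 - k)) iVk.
rewrite -RintegralZl// -RintegralD//; last exact: integrable_cst_itv.
apply: le_Rintegral => //.
  exact: (integrableD mD (integrable_cst_itv _ _ c false true) icVk).
by move=> a _; exact: le_cst_powR.
Qed.

(* The threshold c = eta/4 * n^(1/k) in Rintegral_VaR_tail_le balances c against
   c^(1-k) / w, both being of order n^(1/k) when w is of order 1/n. *)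
Lemma VaR_tail_littleo (p C eta : R) : p < 1 -> 0 < eta ->
  \forall n \near \oo, forall w, 0 < w -> n%:R * w = 1 - p -> w < 1 ->
    C + w^-1 * \int[mu]_(a in `](1 - w)%R, 1[) VaR a X <=
    eta * n%:R `^ k^-1.
Proof.
move=> p1 eta0; have k0 : 0 < k by rewrite (lt_le_trans ltr01).
have q0 : 0 < 1 - p by rewrite subr_gt0.
have e40 : 0 < eta / 4 by rewrite divr_gt0.
(* With [N = n^(1/k)] and [c = eta/4 * N], one has [c^(1-k) = K * N * w], because
   [N^(-k) = 1/n = w / (1 - p)]. A k-th power tail below [(eta/4) / K] thus contributes at most
   [eta/4 * N] after division by [w]. *)
pose K := (eta / 4) `^ (1 - k) / (1 - p).
have K0 : 0 < K by rewrite divr_gt0// powR_gt0.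
have [r r0 rI] := Rintegral_VaR_powR_tail (divr_gt0 e40 K0).
near=> n => w w0 nw w1.
have n0 : 0 < n%:R :> R by rewrite ltr0n; near: n; exact: nbhs_infty_gt.
have wr : w < r.
  rewrite -(ltr_pM2l n0) nw -ltr_pdivrMr//.
  by near: n; exact: nbhs_infty_gtr.
set N := n%:R `^ k^-1.
have N0 : 0 < N by rewrite powR_gt0.
have CN : C <= eta / 4 * N.
  rewrite mulrC -ler_pdivrMr//.
  by rewrite /N; near: n; exact: powR_natr_ge.
have cE : (eta / 4 * N) `^ (1 - k) = K * N * w.
  rewrite powRM ?ltW// /K -!mulrA; congr (_ * _).
  rewrite /N -powRrM mulrBr mulr1 mulVf ?gt_eqF// powRB; last first.
    by apply/implyP => _; rewrite gt_eqF.
  rewrite powRr1 ?ltW// -nw invfM.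
  by field; rewrite !gt_eqF.
have tail := Rintegral_VaR_tail_le w0 w1 (mulr_gt0 e40 N0).
rewrite cE in tail.
set I := \int[mu]_(a in _) _.
have IN : w^-1 * I <= eta / 4 * N + eta / 4 * N.
  rewrite mulrC ler_pdivrMr//; apply: (le_trans tail).
  rewrite [leRHS]mulrDl lerD2l.
  rewrite [leLHS](_ : _ = (K * \int[mu]_(a in `](1 - w)%R, 1[) (`|VaR a X| `^ k)) *
    (N * w)); last by ring.
  rewrite -[leRHS]mulrA ler_pM2r ?mulr_gt0// mulrC -ler_pdivlMr//.
  exact: ltW (rI _ w0 wr w1).
have : 0 < eta / 4 * N by rewrite mulr_gt0.
lra.
Unshelve. all: by end_near. Qed.

End moment.

(** * The gap between the two suprema, and the asymptotic ratio *)

Section gap.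
Context (d : measure_display) (T : measurableType d) (R : realType).
Variables (P : probability T R) (F : probability R R) (X : {RV P >-> R}).
Hypotheses (P_rich : generates_independent_vectors P).
Hypotheses (XF : has_law X F) (iX : P.-integrable setT (EFin \o X)).
Variable p : R.
Hypothesis p01 : 0 < p < 1.
Local Notation mu := (@lebesgue_measure R).
Local Notation es := ((1 - p)^-1 * \int[mu]_(a in `]p, 1[) VaR a X).

Lemma sup_VaR_gap (M : nat) (w : R) : 0 < w -> w < p / 2 ->
  M.+1%:R * w = 1 - p ->
  exists v : R, [/\ sup_VaR P p F M.+2 = v%:E, v <= M.+2%:R * es &
    M.+2%:R * es - v <= es - VaR (p / 2) X - VaR p X +
      w^-1 * \int[mu]_(a in `](1 - w)%R, 1[) VaR a X].
Proof.
move=> w0 wp Mw; have [p0 p1] := andP p01.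
have ub := sup_VaR_le XF iX p01 M.+2.
have wltp : w < p by lra.
have lb := sup_VaR_ge XF iX P_rich p01 w0 wltp Mw.
have fV : sup_VaR P p F M.+2 \is a fin_num.
  rewrite fin_numE gt_eqF ?lt_eqF// ?(le_lt_trans ub) ?ltry//.
  by rewrite (lt_le_trans _ lb) ?ltNyr.
exists (fine (sup_VaR P p F M.+2)); rewrite fineK//; split => //.
  by rewrite -lee_fin fineK.
move: lb; rewrite -[in leRHS](fineK fV) lee_fin.
(* Replacing [p - w] by [p / 2] makes the constant in the bound independent of [w], hence of the
   number of summands. *)
have VaRpw : VaR (p / 2) X <= VaR (p - w) X.
  by apply: VaR_nondecreasing; lra.
have w1 : 1 - w < 1 by lra.
have pw : p <= 1 - w.
  by rewrite lerBrDr -lerBrDl -Mw ler_peMl ?(ltW w0)// ler1n.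
have sub01 : `]p, 1[%classic `<=` (`]0, 1[%classic : set R).
  by apply: subset_itvr; rewrite bnd_simp ltW.
have itvU : `]p, 1[%classic =
    `]p, (1 - w)]%classic `|` `](1 - w), 1[%classic :> set R.
  by rewrite -itv_bndbnd_setU// bnd_simp.
have Jsplit : \int[mu]_(a in `]p, 1[) VaR a X =
    \int[mu]_(a in `]p, (1 - w)%R]) VaR a X +
    \int[mu]_(a in `](1 - w)%R, 1[) VaR a X.
  rewrite itvU Rintegral_setU//=.
    by rewrite -itvU; exact: integrable_VaR.
  apply/disj_set2P; rewrite -subset0 => z/=; rewrite !in_itv/= => -[/andP[_]].
  by rewrite leNgt => /negbTE ->.
(* Of the [M.+2] copies of [es], [M.+1] turn into the integral scaled by [w^-1]; its part up to
   [1 - w] cancels against the lower bound, leaving the tail. *)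
have wes : M.+1%:R * es = w^-1 * \int[mu]_(a in `]p, 1[) VaR a X.
  rewrite mulrA -Mw; congr (_ * _); field.
  by rewrite gt_eqF//= pnatr_eq0.
rewrite -natr1 mulrDl mul1r wes Jsplit mulrDr => lb.
have arith (a b c e v x y : R) : a <= b -> b + c + x <= v ->
  x + y + e - v <= e - a - c + y by lra.
exact: arith VaRpw lb.
Qed.

End gap.

Unset Implicit Arguments.

Theorem corollary3p8 (R : realType) (d : measure_display)
    (T : measurableType d) (P : probability T R)
    (P_atomless : atomless P) (P_rich : generates_independent_vectors P)
    (p : R) (p_gt0 : 0 < p) (p_lt1 : p < 1)
    (k : R) (k_ge1 : 1 <= k)
    (F : probability R R)
    (X : {RV P >-> R}) (X_law : has_law X F)
    (X_moment : ('E_P[fun w => (`|X w| `^ k)%R] < +oo)%E)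
    (ES_neq0 : ES p X <> 0%E) :
  exists2 e : nat -> R,
    e =o_\oo (fun n : nat => (n%:R : R) `^ (- 1 + k^-1)) &
    \forall n \near \oo,
      (sup_VaR P p F n / sup_ES P p F n)%E = (1 - e n)%:E.
Proof.
have iX := moment_integrable k_ge1 X_moment.
have p2_lt1 : p / 2 < 1 by lra.
have p01 : 0 < p < 1 by rewrite p_gt0.
move: ES_neq0; rewrite (ESE iX)//.
set es := (1 - p)^-1 * _ => /eqP; rewrite eqe => es_neq0.
have es_gt0 : 0 < `|es| by rewrite normr_gt0.
have k_gt0 : 0 < k by rewrite (lt_le_trans ltr01).
(* The relative gap itself; [fine] loses nothing, since [gap_le] makes the supremum a real number
   for large [n]. *)
pose e (n : nat) : R := 1 - fine (sup_VaR P p F n) / (n%:R * es).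
pose C := es - VaR (p / 2) X - VaR p X.
(* The predecessor appears because [n] summands go with the cell width [(1 - p) / (n - 1)]. *)
pose tail_le (eta : R) n := forall w, 0 < w -> n.-1%:R * w = 1 - p -> w < 1 ->
  C + w^-1 * \int[@lebesgue_measure R]_(a in `](1 - w)%R, 1[) VaR a X <=
  eta * n.-1%:R `^ k^-1.
pose gap_le n := exists v : R, [/\ sup_VaR P p F n = v%:E, v <= n%:R * es &
  forall eta, tail_le eta n -> n%:R * es - v <= eta * n.-1%:R `^ k^-1].
have gap : \forall n \near \oo, gap_le n.
  have [N _ HN] : \forall n \near \oo, (1 - p) / (p / 2) < n%:R.
    exact: nbhs_infty_gtr.
  exists N.+2 => // -[|[|M]]//= NM.
  have M0 : 0 < M.+1%:R :> R by rewrite ltr0n.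
  have w0 : 0 < (1 - p) / M.+1%:R by rewrite divr_gt0// subr_gt0.
  have Mw : M.+1%:R * ((1 - p) / M.+1%:R) = 1 - p.
    by rewrite mulrC divfK// gt_eqF.
  have wp : (1 - p) / M.+1%:R < p / 2.
    rewrite ltr_pdivrMr// mulrC -ltr_pdivrMr ?divr_gt0//.
    by apply: HN; rewrite /= ltnW// -ltnS.
  have [v [vE vle vgap]] := sup_VaR_gap P_rich X_law iX p01 w0 wp Mw.
  exists v; split => // eta tail.
  apply: (le_trans vgap); exact: tail (lt_trans wp p2_lt1).
exists e.
  apply/eqoP => eps eps0.
  (* Since [es] may be negative, its absolute value is absorbed into the tolerance. *)
  have eta0 : 0 < eps * `|es| by rewrite mulr_gt0.
  have [N _ HN] := VaR_tail_littleo k_ge1 X_moment C p_lt1 eta0.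
  have tail : \forall n \near \oo, tail_le (eps * `|es|) n.
    by exists N.+1 => // -[//|n] Nn; exact: HN.
  near=> n.
  have n0 : 0 < n%:R :> R by rewrite ltr0n; near: n; exact: nbhs_infty_gt.
  have [v [vE vle /(_ (eps * `|es|)) vgap]] : gap_le n by near: n.
  have nes : n%:R * es != 0 by rewrite mulf_neq0// gt_eqF.
  have eE : e n = (n%:R * es - v) / (n%:R * es).
    by rewrite /e vE /= mulrBl divff.
  have gap_ge0 : 0 <= n%:R * es - v by rewrite subr_ge0.
  rewrite eE normrM normfV (ger0_norm gap_ge0) normrM (gtr0_norm n0).
  (* Clearing the denominator turns [n^(-1+1/k)] into [n^(1/k)], the scale of the tail bound. *)
  rewrite ler_pdivrMr ?mulr_gt0// (ger0_norm (powR_ge0 _ _)).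
  rewrite powRD; last by apply/implyP => _; rewrite gt_eqF.
  rewrite (powR_inv1 (ltW n0)).
  rewrite [leRHS](_ : _ = eps * `|es| * n%:R `^ k^-1); last first.
    by field; rewrite gt_eqF.
  apply: le_trans (vgap _) _; first by near: n.
  rewrite ler_pM2l//; apply: ge0_ler_powR.
  - by rewrite invr_ge0 ltW.
  - by rewrite nnegrE.
  - by rewrite nnegrE.
  - by rewrite ler_nat leq_pred.
near=> n.
have n0 : (0 < n)%N by near: n; exact: nbhs_infty_gt.
have [v [vE _ _]] : gap_le n by near: n.
have nes : n%:R * es != 0 by rewrite mulf_neq0// pnatr_eq0 -lt0n.
rewrite (sup_ESE X_law iX p01 n0) -/es vE inver (negbTE nes) -EFinM /e vE /=.
by rewrite subKr.
Unshelve. all: by end_near. Qed.
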